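(* Let $\Sigma$ be a set. Then $T^1(\Sigma)$, equipped with pruned multiplication, the unary operations $+$ and $*$, and the trivial tree as distinguished identity, is a free object in the quasivariety of adequate monoids (viewed as $(2,1,1,0)$-algebras), freely generated by the set $\Sigma$ of base trees. That is, for every adequate monoid $M$ and every function $\chi:\Sigma\to M$ there is a unique $(2,1,1,0)$-morphism $T^1(\Sigma)\to M$ extending $\chi$.
   Context: Adequate monoids: for a semigroup $S$ let $S^1=S$ if $S$ is a monoid and otherwise $S$ with an identity adjoined. Define $a\,\mathcal{L}^*\,b$ iff for all $x,y\in S^1$: $ax=ay\Leftrightarrow bx=by$; and $a\,\mathcal{R}^*\,b$ iff for all $x,y\in S^1$: $xa=ya\Leftrightarrow xb=yb$. $S$ is adequate if its idempotents commute and every $\mathcal{L}^*$-class and every $\mathcal{R}^*$-class contains an idempotent (then necessarily a unique one); $x^+$ denotes the unique idempotent $\mathcal{R}^*$-related to $x$ and $x^*$ the unique idempotent $\mathcal{L}^*$-related to $x$. Adequate monoids are regarded as $(2,1,1,0)$-algebras (multiplication, $+$, $*$, identity), and morphisms must preserve all these operations. Trees: A $\Sigma$-tree is a finite directed graph whose underlying undirected graph is a tree, with each edge labelled by an element of $\Sigma$, together with a distinguished start vertex and end vertex such that there is a (possibly empty) directed path from the start vertex to the end vertex (the trunk). A tree with a single vertex is trivial; a base tree has exactly one edge, with start vertex the initial vertex of the edge and end vertex its terminal vertex; the base tree with label $a$ is identified with $a\in\Sigma$. A morphism $X\to Y$ of $\Sigma$-trees maps vertices to vertices and edges to edges, preserving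 the initial vertex, terminal vertex and label of each edge, and maps the start and end vertices of $X$ to those of $Y$; an isomorphism is a morphism bijective on vertices and edges. A retraction of $X$ is an idempotent morphism $X\to X$, its image (with the same start and end vertices) being a retract; $X$ is pruned if it admits no non-identity retraction. Every tree $X$ has a pruned retract, unique up to isomorphism; its isomorphism type is denoted $\overline{X}$. $T^1(\Sigma)$ is the set of isomorphism types of pruned $\Sigma$-trees. Unpruned operations: $X\times Y$ is obtained from disjoint copies of $X$ and $Y$ by identifying the end vertex of $X$ with the start vertex of $Y$, with start vertex that of $X$ and end vertex that of $Y$; $X^{(+)}$ has the same graph and start vertex as $X$ but end vertex equal to the start vertex; $X^{( * )}$ has the same graph and end vertex as $X$ but start vertex equal to the end vertex. Pruned operations on $T^1(\Sigma)$: $XY=\overline{X\times Y}$, $X^+=\overline{X^{(+)}}$, $X^*=\overline{X^{( * )}}$. *)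

(* Defs.v *)
From mathcomp Require Import all_boot.
From Stdlib Require Import ClassicalEpsilon.

Set Implicit Arguments.
Unset Strict Implicit.
Unset Printing Implicit Defensive.

Record tree (Sigma : Type) := Tree {
  tV : finType;
  tE : finType;
  src : tE -> tV;
  tgt : tE -> tV;
  lbl : tE -> Sigma;
  st : tV;
  en : tV }.

Arguments Tree {Sigma}.

Section Trees.
Variable Sigma : Type.
Implicit Types X Y : tree Sigma.

Definition uadj X : rel (tV X) := fun u v =>
  [exists e, ((src e == u) && (tgt e == v)) || ((src e == v) && (tgt e == u))].

Definition dadj X : rel (tV X) := fun u v =>
  [exists e, (src e == u) && (tgt e == v)].

Definition connectedT X : Prop := forall u v : tV X, connect (@uadj X) u v.

(* an (undirected) cycle: a nonempty closed walk using pairwise distinct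
   edges, each traversed forwards (true) or backwards (false) *)
Definition ufrom X (x : tE X * bool) : tV X := if x.2 then src x.1 else tgt x.1.
Definition uto X (x : tE X * bool) : tV X := if x.2 then tgt x.1 else src x.1.

Definition is_ucycle X (s : seq (tE X * bool)) : Prop :=
  s != [::] /\ uniq (map fst s) /\
  cycle (fun x y : tE X * bool => uto x == ufrom y) s.

Definition acyclicT X : Prop := forall s : seq (tE X * bool), ~ is_ucycle s.

Definition is_tree X : Prop :=
  connectedT X /\ acyclicT X /\ connect (@dadj X) (st X) (en X).

Definition is_morph X Y (fv : tV X -> tV Y) (fe : tE X -> tE Y) : Prop :=
  (forall e, src (fe e) = fv (src e)) /\
  (forall e, tgt (fe e) = fv (tgt e)) /\
  (forall e, lbl (fe e) = lbl e) /\
  fv (st X) = st Y /\ fv (en X) = en Y.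

Definition is_iso X Y (fv : tV X -> tV Y) (fe : tE X -> tE Y) : Prop :=
  is_morph fv fe /\ bijective fv /\ bijective fe.

Definition iso X Y : Prop := exists fv fe, @is_iso X Y fv fe.

Definition is_retraction X (r : tV X -> tV X) (re : tE X -> tE X) : Prop :=
  is_morph r re /\ (forall v, r (r v) = r v) /\ (forall e, re (re e) = re e).

Definition pruned X : Prop :=
  forall r re, @is_retraction X r re -> (forall v, r v = v) /\ (forall e, re e = e).

Definition retract_of X Y : Prop :=
  exists r re, @is_retraction X r re /\
  exists (j : tV Y -> tV X) (je : tE Y -> tE X),
    is_morph j je /\ injective j /\ injective je /\
    (forall v, (exists w, j w = v) <-> (exists v', r v' = v)) /\
    (forall e, (exists d, je d = e) <-> (exists e', re e' = e)).

Definition inY X Y (v : tV Y) : (tV X + {w : tV Y | w != st Y})%type :=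
  match insub v with Some w => inr w | None => inl (en X) end.

Definition prodT X Y : tree Sigma :=
  @Tree Sigma (tV X + {w : tV Y | w != st Y})%type (tE X + tE Y)%type
    (fun e => match e with inl d => inl (src d) | inr d => inY X (src d) end)
    (fun e => match e with inl d => inl (tgt d) | inr d => inY X (tgt d) end)
    (fun e => match e with inl d => lbl d | inr d => lbl d end)
    (inl (st X)) (inY X (en Y)).

Definition plusT X : tree Sigma :=
  @Tree Sigma (tV X) (tE X) (@src _ X) (@tgt _ X) (@lbl _ X) (st X) (st X).

Definition starT X : tree Sigma :=
  @Tree Sigma (tV X) (tE X) (@src _ X) (@tgt _ X) (@lbl _ X) (en X) (en X).

Definition trivialT : tree Sigma :=
  @Tree Sigma unit void (fun e => match e with end) (fun e => match e with end)
    (fun e => match e with end) tt tt.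

Definition baseT (a : Sigma) : tree Sigma :=
  @Tree Sigma bool unit (fun _ => false) (fun _ => true) (fun _ => a) false true.

(* T^1(Sigma): isomorphism types of pruned Sigma-trees.  An isomorphism
   type is represented by the predicate [iso X]. *)
Definition is_T1class (C : tree Sigma -> Prop) : Prop :=
  exists X, is_tree X /\ pruned X /\ C = iso X.

Definition T1 : Type := {C : tree Sigma -> Prop | is_T1class C}.

Definition rep (C : T1) : tree Sigma :=
  proj1_sig (constructive_indefinite_description _ (proj2_sig C)).

Lemma trivialT_is_tree : is_tree trivialT.
Proof.
split; [|split].
- by move=> [] []; apply: connect0.
- by move=> [|[[] ?] ?] [].
- exact: connect0.
Qed.

Lemma trivialT_pruned : pruned trivialT.
Proof. by move=> r re _; split=> [[]|[]]; case: (r tt). Qed.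

Lemma T1_inhabited : inhabited T1.
Proof.
constructor; exists (iso trivialT); exists trivialT.
by split; [exact: trivialT_is_tree | split; [exact: trivialT_pruned|]].
Qed.

Definition overline X : T1 :=
  epsilon T1_inhabited
    (fun C => exists Y, retract_of X Y /\ pruned Y /\ proj1_sig C = iso Y).

Definition mulT1 (C D : T1) : T1 := overline (prodT (rep C) (rep D)).
Definition plusT1 (C : T1) : T1 := overline (plusT (rep C)).
Definition starT1 (C : T1) : T1 := overline (starT (rep C)).
Definition oneT1 : T1 := overline trivialT.
(* the generator corresponding to a in Sigma (the base tree a, which is
   its own pruned retract) *)
Definition genT1 (a : Sigma) : T1 := overline (baseT a).

End Trees.

Section Adequate.
Variables (M : Type) (mul : M -> M -> M) (plus star : M -> M) (one : M).

Definition idem (e : M) : Prop := mul e e = e.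

(* M is a monoid, so M^1 = M *)
Definition Lstar (a b : M) : Prop :=
  forall x y : M, mul a x = mul a y <-> mul b x = mul b y.
Definition Rstar (a b : M) : Prop :=
  forall x y : M, mul x a = mul y a <-> mul x b = mul y b.

Definition is_monoid : Prop :=
  (forall x y z, mul x (mul y z) = mul (mul x y) z) /\
  (forall x, mul one x = x) /\ (forall x, mul x one = x).

(* idempotents commute, and x^+ (resp. x^* ) is an idempotent in the
   R*-class (resp. L*-class) of x (necessarily the unique one) *)
Definition adequate_monoid : Prop :=
  is_monoid /\
  (forall e f, idem e -> idem f -> mul e f = mul f e) /\
  (forall a, idem (plus a) /\ Rstar a (plus a)) /\
  (forall a, idem (star a) /\ Lstar a (star a)).

End Adequate.

Definition is_hom (A B : Type)
  (mulA : A -> A -> A) (plusA starA : A -> A) (oneA : A)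
  (mulB : B -> B -> B) (plusB starB : B -> B) (oneB : B) (f : A -> B) : Prop :=
  (forall x y, f (mulA x y) = mulB (f x) (f y)) /\
  (forall x, f (plusA x) = plusB (f x)) /\
  (forall x, f (starA x) = starB (f x)) /\
  f oneA = oneB.

(* Main.v *)
(* Finite cores: a pruned tree is determined up to isomorphism by its class for
   homomorphic equivalence, so T^1(Sigma) is the set of trees modulo mutual
   homomorphisms, and the identities of an adequate monoid only require
   exhibiting homomorphisms.  The cancellation-type conditions hold because a
   homomorphism X x A -> Y x A preserves the trunk, hence the gluing vertex.

   Every tree is equivalent to the realization of a (2,1,1,0)-term (cut an edge
   at the start vertex and recurse), which gives uniqueness.  For existence, fix
   chi : Sigma -> M and call a labelling lam of the vertices by idempotents of M
   good if lam u <= (chi a * lam v)^+ and lam v <= (lam u * chi a)^* for every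
   edge u -a-> v.  Good labellings pull back along homomorphisms.  By induction
   on a term t, its realization has a greatest good labelling, and the value of
   t is lam v_0 * chi a_1 * lam v_1 * ... * chi a_n * lam v_n along the trunk.
   Mutual homomorphisms identify the trunks and, by maximality, the greatest
   labellings on them, so equivalent realizations have equal values. *)
Require Import Defs.
From mathcomp Require Import all_boot.
From mathcomp Require Import zify.
From Stdlib Require Import Classical ClassicalEpsilon FunctionalExtensionality
  PropExtensionality ProofIrrelevance.

Set Implicit Arguments.
Unset Strict Implicit.
Unset Printing Implicit Defensive.

Lemma connect_ind (T : finType) (r : rel T) (P : T -> Prop) (u v : T) :
  P u -> (forall x y, P x -> r x y -> P y) -> connect r u v -> P v.
Proof.
move=> Pu step /connectP [p pth ->] {v}.
elim: p u Pu pth => [|w p IH] u Pu //= /andP [ruw pth].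
by apply: IH pth; apply: step ruw.
Qed.

(** * Homomorphisms and products *)

Section Homs.
Variable Sigma : Type.
Implicit Types (X Y Z W : tree Sigma) (a : Sigma).

Definition step X (u : tV X) a (v : tV X) : Prop :=
  exists e : tE X, src e = u /\ tgt e = v /\ lbl e = a.

(* Only vertices are recorded: an edge map can be chosen afterwards. *)
Definition vhom X Y (f : tV X -> tV Y) : Prop :=
  forall u a v, step u a v -> step (f u) a (f v).

Definition hom X Y : Prop :=
  exists f : tV X -> tV Y, [/\ vhom f, f (st X) = st Y & f (en X) = en Y].

Definition eqv X Y : Prop := hom X Y /\ hom Y X.

Lemma step_edge X (e : tE X) : step (src e) (lbl e) (tgt e).
Proof. by exists e. Qed.

Lemma vhom_comp X Y Z (f : tV X -> tV Y) (g : tV Y -> tV Z) :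
  vhom f -> vhom g -> vhom (g \o f).
Proof. by move=> hf hg u a v /hf /hg. Qed.

Lemma morph_vhom X Y (f : tV X -> tV Y) fe : is_morph f fe -> vhom f.
Proof.
move=> [hs [ht [hl _]]] u a v [e [<- [<- <-]]].
by exists (fe e); rewrite hs ht hl.
Qed.

Lemma morph_hom X Y (f : tV X -> tV Y) fe : is_morph f fe -> hom X Y.
Proof.
move=> m; exists f; split; first exact: morph_vhom m.
  by case: m => _ [_ [_ []]].
by case: m => _ [_ [_ []]].
Qed.

Lemma hom_morph X Y :
  hom X Y -> exists (f : tV X -> tV Y) fe, is_morph f fe.
Proof.
move=> [f [hf fs fe]].
pose ex (e : tE X) := constructive_indefinite_description _ (hf _ _ _ (step_edge e)).
exists f, (fun e => proj1_sig (ex e)).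
by do 3?[split]; do ?[move=> e; case: (ex e) => /= d [? []]].
Qed.

Lemma hom_refl X : hom X X.
Proof. by exists id; split. Qed.

Lemma hom_trans Y X Z : hom X Y -> hom Y Z -> hom X Z.
Proof.
move=> [f [hf fs fe]] [g [hg gs ge]]; exists (g \o f).
by split; [exact: vhom_comp hf hg | rewrite /= fs | rewrite /= fe].
Qed.

Lemma eqv_refl X : eqv X X.
Proof. by split; exact: hom_refl. Qed.

Lemma eqv_sym X Y : eqv X Y -> eqv Y X.
Proof. by case. Qed.

Lemma eqv_trans Y X Z : eqv X Y -> eqv Y Z -> eqv X Z.
Proof. by move=> [? ?] [? ?]; split; apply: (hom_trans (Y := Y)). Qed.

(* [inl] and [inY], typed with codomain the vertices of the product. *)
Definition injl X Y (x : tV X) : tV (prodT X Y) := inl x.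
Definition injr X Y (y : tV Y) : tV (prodT X Y) := inY X y.
Arguments injl {X Y}.
Arguments injr {X Y}.

Lemma injr_st X Y : injr (st Y) = injl (en X) :> tV (prodT X Y).
Proof. by rewrite /injr /inY insubF ?eqxx. Qed.

Lemma prodT_ind X Y (P : tV (prodT X Y) -> Prop) :
  (forall x, P (injl x)) -> (forall y, P (injr y)) -> forall z, P z.
Proof.
move=> Pl Pr [x|w]; first exact: Pl.
by have := Pr (val w); rewrite /injr /inY valK.
Qed.

Lemma vhom_injl X Y : vhom (@injl X Y).
Proof. by move=> u a v [e [<- [<- <-]]]; exists (inl e). Qed.

Lemma vhom_injr X Y : vhom (@injr X Y).
Proof. by move=> u a v [e [<- [<- <-]]]; exists (inr e). Qed.

Lemma prod_step X Y (u v : tV (prodT X Y)) a : step u a v ->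
  (exists x x' : tV X, [/\ u = injl x, v = injl x' & step x a x']) \/
  (exists y y' : tV Y, [/\ u = injr y, v = injr y' & step y a y']).
Proof.
move=> [[e|e] [<- [<- <-]]]; [left|right].
  by exists (src e), (tgt e); split=> //; exact: step_edge.
by exists (src e), (tgt e); split=> //; exact: step_edge.
Qed.

(** The universal map out of the gluing. The glued vertex is stored on the left, so its value comes
    from [f]; [g] is recovered on all of [Y] only when [f (en X) = g (st Y)]. *)
Definition copair X Y (T : Type) (f : tV X -> T) (g : tV Y -> T)
  (z : tV (prodT X Y)) : T :=
  match z with inl x => f x | inr w => g (val w) end.

Lemma copair_injr X Y (T : Type) (f : tV X -> T) (g : tV Y -> T) y :
  f (en X) = g (st Y) -> copair f g (injr y) = g y.
Proof.
move=> fg; rewrite /copair /injr /inY; case: insubP => [w _ -> //|].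
by rewrite negbK => /eqP ->.
Qed.

Lemma vhom_copair X Y Z (f : tV X -> tV Z) (g : tV Y -> tV Z) :
  f (en X) = g (st Y) -> vhom f -> vhom g -> vhom (copair f g).
Proof.
move=> fg hf hg u a v /prod_step [] [x [x' [-> -> s]]]; first exact: hf.
by rewrite !copair_injr //; exact: hg.
Qed.

Lemma hom_prod_glue X Y Z (f : tV X -> tV Z) (g : tV Y -> tV Z) :
  vhom f -> vhom g -> f (st X) = st Z -> f (en X) = g (st Y) -> g (en Y) = en Z ->
  hom (prodT X Y) Z.
Proof.
move=> hf hg fs fg ge; exists (copair f g).
by split=> //; [exact: vhom_copair | rewrite copair_injr].
Qed.

Lemma hom_prod X X' Y Y' : hom X X' -> hom Y Y' -> hom (prodT X Y) (prodT X' Y').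
Proof.
move=> [f [hf fs fe]] [g [hg gs ge]].
apply: (@hom_prod_glue X Y (prodT X' Y') (injl \o f) (injr \o g)) => /=.
- exact: vhom_comp hf (@vhom_injl X' Y').
- exact: vhom_comp hg (@vhom_injr X' Y').
- by rewrite fs.
- by rewrite fe gs injr_st.
- by rewrite ge.
Qed.

Lemma eqv_prod X X' Y Y' : eqv X X' -> eqv Y Y' -> eqv (prodT X Y) (prodT X' Y').
Proof. by move=> [? ?] [? ?]; split; exact: hom_prod. Qed.

Lemma eqv_plus X Y : eqv X Y -> eqv (plusT X) (plusT Y).
Proof. by move=> [[f [hf fs fe]] [g [hg gs ge]]]; split; [exists f | exists g]. Qed.

Lemma eqv_star X Y : eqv X Y -> eqv (starT X) (starT Y).
Proof. by move=> [[f [hf fs fe]] [g [hg gs ge]]]; split; [exists f | exists g]. Qed.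

Lemma prod_assoc X Y Z : eqv (prodT X (prodT Y Z)) (prodT (prodT X Y) Z).
Proof.
split.
- apply: (@hom_prod_glue X (prodT Y Z) (prodT (prodT X Y) Z)
    (injl \o injl) (copair (injl \o injr) injr)).
  + exact: vhom_comp (@vhom_injl X Y) (@vhom_injl (prodT X Y) Z).
  + apply: vhom_copair; first by rewrite injr_st.
      exact: vhom_comp (@vhom_injr X Y) (@vhom_injl (prodT X Y) Z).
    exact: vhom_injr.
  + by [].
  + by rewrite /= injr_st.
  + by rewrite copair_injr ?injr_st.
- apply: (@hom_prod_glue (prodT X Y) Z (prodT X (prodT Y Z))
    (copair injl (injr \o injl)) (injr \o injr)).
  + apply: vhom_copair; first by rewrite -(injr_st X (prodT Y Z)).
      exact: vhom_injl.
    exact: vhom_comp (@vhom_injl Y Z) (@vhom_injr X (prodT Y Z)).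
  + exact: vhom_comp (@vhom_injr Y Z) (@vhom_injr X (prodT Y Z)).
  + by [].
  + by rewrite copair_injr /= ?injr_st // -(injr_st X (prodT Y Z)).
  + by [].
Qed.

Lemma vhom_trivial X (f : tV (trivialT Sigma) -> tV X) : vhom f.
Proof. by move=> u a v [[]]. Qed.

Lemma prod_trivial_l X : eqv (prodT (trivialT Sigma) X) X.
Proof.
split.
- apply: (@hom_prod_glue _ X X (fun _ => st X) id) => //; exact: vhom_trivial.
- exists injr; split; [exact: vhom_injr | exact: injr_st | by []].
Qed.

Lemma prod_trivial_r X : eqv (prodT X (trivialT Sigma)) X.
Proof.
split.
- apply: (@hom_prod_glue X _ X id (fun _ => en X)) => //; exact: vhom_trivial.
- by exists injl; split; [exact: vhom_injl | | rewrite -injr_st].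
Qed.

Lemma prod_loop_idem X : st X = en X -> eqv (prodT X X) X.
Proof.
move=> e; split.
- by apply: (@hom_prod_glue X X X id id).
- exists injl; split; [exact: vhom_injl | by [] |].
  by rewrite -injr_st {1}e.
Qed.

Lemma hom_prod_loop_swap X Y :
  st X = en X -> st Y = en Y -> hom (prodT X Y) (prodT Y X).
Proof.
move=> eX eY.
apply: (@hom_prod_glue X Y (prodT Y X) injr injl).
- exact: vhom_injr.
- exact: vhom_injl.
- by rewrite injr_st -eY.
- by rewrite -eX injr_st -eY.
- by rewrite -injr_st {1}eX.
Qed.
End Homs.

Arguments injl {Sigma X Y}.
Arguments injr {Sigma X Y}.

(** * Trees and trunks *)

Section Bridges.
Variable Sigma : Type.
Implicit Types (X Y Z W : tree Sigma) (a : Sigma).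

(** A two-colouring whose only bichromatic edge is [e]: a certificate that [e] is a bridge.
    Colourings extend over gluings and restrict to retracts, whereas cycles are awkward to
    transport. *)
Definition cut X (e : tE X) (c : tV X -> bool) : Prop :=
  c (src e) != c (tgt e) /\ forall d, d != e -> c (src d) = c (tgt d).

Definition bridged X : Prop := forall e : tE X, exists c, cut e c.

Definition adj_without X (e : tE X) : rel (tV X) := fun u v =>
  [exists d, (d != e) &&
    (((src d == u) && (tgt d == v)) || ((src d == v) && (tgt d == u)))].

Lemma adj_without_sym X (e : tE X) : symmetric (adj_without e).
Proof. by move=> u v; apply: eq_existsb => d; rewrite orbC. Qed.

(** The remaining edges of a cycle avoid its first edge, so the colouring that cuts this edge is
    constant along them and agrees at both its ends, which is absurd. *)
Lemma bridged_acyclic X : bridged X -> acyclicT X.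
Proof.
move=> br [|x s] [] // _ [/= /andP [xs _] pth].
have [c [ce cd]] := br x.1.
suff E : c (uto x) = c (ufrom x).
  by move: ce; rewrite /uto /ufrom in E *; case: x.2 E => ->; rewrite eqxx.
have gen z : path (fun x y => uto x == ufrom y) z (rcons s x) ->
    c (uto z) = c (ufrom x); last exact: gen.
elim: s xs z {pth} => [|y s IH] /=; first by move=> _ z /=; rewrite andbT => /eqP ->.
rewrite inE negb_or => /andP [xy xs] z /andP [/eqP -> pth].
rewrite -(IH xs y pth) /ufrom /uto.
by case: y.2; rewrite cd // eq_sym.
Qed.

(** A simple vertex path uses distinct edges: the later ones have both ends in the tail, while the
    first one touches [u]. Quantifying over [z] lets a closing edge be put in front. *)
Lemma adj_path_edges X (e : tE X) p (u : tV X) :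
  path (adj_without e) u p -> uniq (u :: p) ->
  exists s : seq (tE X * bool),
    [/\ uniq (map fst s), e \notin map fst s,
       (forall d, d \in map fst s -> src d \in u :: p /\ tgt d \in u :: p) &
       forall z, uto z = u ->
         path (fun x y => uto x == ufrom y) z s /\ uto (last z s) = last u p].
Proof.
elim: p u => [|v p IH] u; first by move=> _ _; exists [::].
move=> /= /andP [/existsP [d /andP [de duv]] pth] /andP [unot un].
have [s [us es sub lnk]] := IH v pth un.
have [b bfrom bto] : exists2 b, ufrom (d, b) = u & uto (d, b) = v.
  by case/orP: duv => /andP [/eqP <- /eqP <-]; [exists true | exists false].
have dends : src d \in [:: u, v & p] /\ tgt d \in [:: u, v & p].
  by case/orP: duv => /andP [/eqP -> /eqP ->]; rewrite !inE !eqxx ?orbT.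
exists ((d, b) :: s); split=> /=.
- rewrite us andbT; apply/negP => /sub [h1 h2].
  by case/orP: duv h1 h2 => /andP [/eqP -> /eqP ->]; rewrite (negPf unot).
- by rewrite inE negb_or es andbT eq_sym.
- move=> d'; rewrite inE => /orP [/eqP -> //|/sub [h1 h2]].
  by split; rewrite inE ?h1 ?h2 orbT.
- move=> z zu; have [h1 h2] := lnk _ bto.
  by rewrite zu bfrom eqxx.
Qed.

Lemma acyclic_bridged X : acyclicT X -> bridged X.
Proof.
(* Colour by reachability from the source without using [e]. If the target were reachable, a simple
   path to it and [e] traversed backwards would form a cycle. *)
move=> ac e; exists (connect (adj_without e) (src e)); split.
  rewrite connect0; apply/negP => /eqP /esym /connectP [p pth lp].
  case: (shortenP pth) lp => q qpth uq _ lq.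
  have [s [us es _ lnk]] := adj_path_edges qpth uq.
  have [h1 h2] := lnk (e, false) erefl.
  apply: (ac ((e, false) :: s)); split=> //; split; first by rewrite /= es us.
  by rewrite /= rcons_path h1 h2 -lq eqxx.
move=> d de; apply: same_connect_r.
  exact/sym_connect_sym/adj_without_sym.
apply: connect1; apply/existsP; exists d.
by rewrite de !eqxx.
Qed.

Fixpoint ewalk X (u : tV X) (s : seq (tE X)) (v : tV X) : Prop :=
  if s is e :: s' then src e = u /\ ewalk (tgt e) s' v else u = v.

Lemma ewalk_cut X (e : tE X) c s u v :
  cut e c -> e \notin s -> ewalk u s v -> c u = c v.
Proof.
move=> [_ cd]; elim: s u => [|d s IH] u /=; first by move=> _ ->.
rewrite inE negb_or => /andP [ed es] [<- /(IH _ es) <-].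
by rewrite cd // eq_sym.
Qed.

Lemma ewalk_before X (e : tE X) s u v : ewalk u s v -> e \in s ->
  exists2 s', e \notin s' & ewalk u s' (src e).
Proof.
elim: s u => [|d s IH] u //= [du w].
rewrite inE; have [->|ed] := eqVneq e d; first by exists [::].
by move=> /(IH _ w) [s' h1 h2]; exists (d :: s'); rewrite //= inE negb_or ed.
Qed.

Lemma bridged_no_return X (e : tE X) s : bridged X -> ~ ewalk (tgt e) s (src e).
Proof.
move=> br w; have [c ce] := br e.
suff [s' es' w'] : exists2 s', e \notin s' & ewalk (tgt e) s' (src e).
  by move: (proj1 ce); rewrite (ewalk_cut ce es' w') eqxx.
by have [|es] := boolP (e \in s); [exact: ewalk_before w | exists s].
Qed.

Lemma bridged_notin X (e : tE X) s v : bridged X -> ewalk (tgt e) s v -> e \notin s.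
Proof.
move=> br w; apply/negP => /(ewalk_before w) [s' _].
exact: bridged_no_return.
Qed.

(** If the walks leave [u] by different edges [e] and [d], take a cut of [e]. The first walk crosses
    [e] exactly once, so [u] and [v] differ in colour; the second never crosses it, as that would
    lead back to the source of [d], so they agree. *)
Lemma ewalk_unique X s1 s2 (u v : tV X) : bridged X ->
  ewalk u s1 v -> ewalk u s2 v -> s1 = s2.
Proof.
move=> br; elim: s1 s2 u => [|e s1 IH] [|d s2] u //=.
- by move=> -> [<-] /(bridged_no_return br).
- by move=> [eu w] uv; rewrite -uv -eu in w; case: (bridged_no_return br w).
move=> [eu w1] [du w2].
have [de|de] := eqVneq d e; first by rewrite de (IH s2 (tgt e)) // -de.
have [c ce] := br e.
have := proj1 ce; rewrite (ewalk_cut ce (bridged_notin br w1) w1).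
suff es2 : e \notin d :: s2 by rewrite eu (@ewalk_cut _ _ _ _ u v ce es2) ?eqxx.
rewrite inE negb_or eq_sym de; apply/negP => /(ewalk_before w2) [s' _].
by rewrite eu -du; exact: bridged_no_return.
Qed.

(** Labels and vertices are recorded instead of edges, so that a bare vertex map transports
    walks. *)
Fixpoint walk X (u : tV X) (s : seq (Sigma * tV X)) (v : tV X) : Prop :=
  if s is x :: s' then step u x.1 x.2 /\ walk x.2 s' v else u = v.

Lemma walk_edges X s (u v : tV X) : walk u s v ->
  exists2 es, ewalk u es v & s = map (fun e => (lbl e, tgt e)) es.
Proof.
elim: s u => [|[a w] s IH] u /=; first by exists [::].
move=> [[e [eu [<- <-]]] /IH [es h ->]].
by exists (e :: es).
Qed.

Lemma walk_unique X s1 s2 (u v : tV X) : bridged X ->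
  walk u s1 v -> walk u s2 v -> s1 = s2.
Proof.
move=> br /walk_edges [e1 w1 ->] /walk_edges [e2 w2 ->].
by rewrite (ewalk_unique br w1 w2).
Qed.

Lemma walk_cat X s1 s2 (u v w : tV X) :
  walk u s1 v -> walk v s2 w -> walk u (s1 ++ s2) w.
Proof. by elim: s1 u => [|x s1 IH] u /= => [->//|[st /IH h] /h]. Qed.

Definition wmap X Y (f : tV X -> tV Y) (s : seq (Sigma * tV X)) :=
  map (fun x => (x.1, f x.2)) s.

Lemma walk_map X Y (f : tV X -> tV Y) s u v :
  vhom f -> walk u s v -> walk (f u) (wmap f s) (f v).
Proof.
by move=> hf; elim: s u => [|x s IH] u /= => [->//|[/hf st /IH h]].
Qed.

Lemma walk_last X s (u v : tV X) : walk u s v -> last u (map snd s) = v.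
Proof. by elim: s u => [|x s IH] u //= [_ /IH]. Qed.

Lemma dconnect_ewalk X (u v : tV X) :
  connect (@dadj _ X) u v -> exists s, ewalk u s v.
Proof.
move=> /connectP [p pth ->] {v}; elim: p u pth => [|w p IH] u /=.
  by exists [::].
move=> /andP [/existsP [e /andP [/eqP <- /eqP <-]] /IH [s ws]].
by exists (e :: s).
Qed.

Lemma dconnect_walk X (u v : tV X) :
  connect (@dadj _ X) u v -> exists s, walk u s v.
Proof.
move=> /dconnect_ewalk [s ws].
exists (map (fun e => (lbl e, tgt e)) s).
elim: s u ws => [|e s IH] u //= [<- /IH]; split=> //; exact: step_edge.
Qed.

Lemma dadj_map X Y (f : tV X -> tV Y) u v : vhom f ->
  connect (@dadj _ X) u v -> connect (@dadj _ Y) (f u) (f v).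
Proof.
move=> hf.
apply: (connect_ind (P := fun x => connect (@dadj _ Y) (f u) (f x))) => [|x y c].
  exact: connect0.
move=> /existsP [e /andP [/eqP xe /eqP <-]]; rewrite -xe in c.
apply: connect_trans c _; apply: connect1; apply/existsP.
have [d [<- [<- _]]] := hf _ _ _ (step_edge e).
by exists d; rewrite !eqxx.
Qed.

(** * Closure of trees under the unpruned operations *)

Lemma uadj_sym X : symmetric (@uadj _ X).
Proof. by move=> u v; apply: eq_existsb => d; rewrite orbC. Qed.

Lemma uadj_map X Y (f : tV X -> tV Y) u v : vhom f ->
  connect (@uadj _ X) u v -> connect (@uadj _ Y) (f u) (f v).
Proof.
move=> hf.
apply: (connect_ind (P := fun x => connect (@uadj _ Y) (f u) (f x))) => [|x y c].
  exact: connect0.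
move=> /existsP [e h].
apply: connect_trans c _; apply: connect1; apply/existsP.
have [d [h1 [h2 _]]] := hf _ _ _ (step_edge e).
by exists d; case/orP: h => /andP [/eqP <- /eqP <-]; rewrite h1 h2 !eqxx ?orbT.
Qed.

Lemma connectedT_to X (w : tV X) :
  (forall u, connect (@uadj _ X) u w) -> connectedT X.
Proof.
move=> h u v; apply: connect_trans (h u) _.
by rewrite (sym_connect_sym (@uadj_sym X)).
Qed.

Lemma is_treeP X : is_tree X <->
  [/\ connectedT X, bridged X & connect (@dadj _ X) (st X) (en X)].
Proof.
split=> [[? [/acyclic_bridged ? ?]]|[? /bridged_acyclic ? ?]]; by [|split].
Qed.

Lemma is_tree_prod X Y : is_tree X -> is_tree Y -> is_tree (prodT X Y).
Proof.
move=> /is_treeP [cX bX dX] /is_treeP [cY bY dY]; apply/is_treeP; split.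
- apply: (@connectedT_to _ (injl (en X))); apply: prodT_ind => [x|y].
    by apply: uadj_map (@vhom_injl _ X Y) _.
  by rewrite -injr_st; apply: uadj_map (@vhom_injr _ X Y) _.
- move=> [e|e].
    have [c [ce cd]] := bX e.
    (* A cut of an edge of [X] gives all of [Y] the colour of the gluing vertex; edges of [Y] are
       treated symmetrically below. *)
    exists (copair c (fun _ => c (en X))).
    have E (y : tV Y) : copair c (fun _ => c (en X)) (@injr _ X Y y) = c (en X).
      by rewrite copair_injr.
    split=> // -[d|d] de; first by apply: cd; apply: contraNneq de => ->.
    exact: etrans (E (src d)) (esym (E (tgt d))).
  have [c [ce cd]] := bY e.
  have E y : copair (fun _ => c (st Y)) c (@injr _ X Y y) = c y.
    by rewrite copair_injr.
  exists (copair (fun _ => c (st Y)) c).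
  split.
    apply: contra ce => /eqP h; apply/eqP.
    exact: etrans (esym (E (src e))) (etrans h (E (tgt e))).
  move=> [d|d] de //.
  apply: etrans (E (src d)) (etrans _ (esym (E (tgt d)))).
  by apply: cd; apply: contraNneq de => ->.
- rewrite -[en (prodT X Y)]/(injr (en Y)) -[st (prodT X Y)]/(injl (st X)).
  apply: (connect_trans (y := injl (en X))).
    exact: dadj_map (@vhom_injl _ X Y) _.
  by rewrite -injr_st; apply: dadj_map (@vhom_injr _ X Y) _.
Qed.

Lemma is_tree_plus X : is_tree X -> is_tree (plusT X).
Proof. by move=> [c [a _]]; split; [|split]; rewrite ?connect0. Qed.

Lemma is_tree_star X : is_tree X -> is_tree (starT X).
Proof. by move=> [c [a _]]; split; [|split]; rewrite ?connect0. Qed.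

Lemma is_tree_base a : is_tree (baseT a).
Proof.
have adj : connect (@dadj _ (baseT a)) false true.
  by apply: connect1; apply/existsP; exists tt.
apply/is_treeP; split=> //.
- apply: (@connectedT_to (baseT a) true) => -[]; first exact: connect0.
  by apply: connect1; apply/existsP; exists tt.
- by move=> [] /=; exists id; split=> // -[].
Qed.

Lemma tree_walk X : is_tree X -> exists s, walk (st X) s (en X).
Proof. by move=> [_ [_ /dconnect_walk]]. Qed.

Lemma tree_walk_unique X s1 s2 (u v : tV X) : is_tree X ->
  walk u s1 v -> walk u s2 v -> s1 = s2.
Proof. by move=> /is_treeP [_ br _]; exact: walk_unique. Qed.

(* A homomorphism maps the trunk of [prodT X A] onto that of [prodT Y B], so it
   preserves the vertex at distance [size sX = size sY] from the start. *)
Lemma hom_junction X Y A B sX sY sA sB (f : tV (prodT X A) -> tV (prodT Y B)) :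
  is_tree Y -> is_tree B ->
  walk (st X) sX (en X) -> walk (st Y) sY (en Y) ->
  walk (st A) sA (en A) -> walk (st B) sB (en B) ->
  vhom f -> f (st (prodT X A)) = st (prodT Y B) ->
  f (en (prodT X A)) = en (prodT Y B) ->
  size sX = size sY \/ size sA = size sB ->
  f (injl (en X)) = injl (en Y).
Proof.
move=> tY tB wX wY wA wB hf fs fe sz.
have w1 : walk (st (prodT X A)) (wmap injl sX ++ wmap injr sA) (en (prodT X A)).
  apply: (walk_cat (v := injl (en X))); first exact: walk_map (@vhom_injl _ X A) wX.
  by rewrite -injr_st; apply: walk_map (@vhom_injr _ X A) wA.
have w2 : walk (st (prodT Y B)) (wmap injl sY ++ wmap injr sB) (en (prodT Y B)).
  apply: (walk_cat (v := injl (en Y))); first exact: walk_map (@vhom_injl _ Y B) wY.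
  by rewrite -injr_st; apply: walk_map (@vhom_injr _ Y B) wB.
have := walk_map hf w1; rewrite fs fe => w3.
have E := tree_walk_unique (is_tree_prod tY tB) w3 w2.
rewrite /wmap map_cat in E.
have szX : size sX = size sY.
  by case: sz => // sz; have := congr1 size E; rewrite !size_cat !size_map; lia.
have {E} := congr1 (take (size sX)) E.
rewrite !take_size_cat ?size_map // => E.
have /walk_last := walk_map hf (walk_map (@vhom_injl _ X A) wX).
rewrite /wmap E => <-.
have /walk_last <- := walk_map (@vhom_injl _ Y B) wY.
by rewrite -[injl (st X)]/(st (prodT X A)) fs.
Qed.

End Bridges.

(** * Pruned retracts *)

(** By pigeonhole two powers [i < j] of [h] agree, so the powers from [i] on have period [j - i]. *)
Lemma iter_idempotent (T : finType) (h : T -> T) :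
  exists2 n, 0 < n & forall x, iter n h (iter n h x) = iter n h x.
Proof.
have [i [j [ij E]]] : exists i j, i < j /\ forall x, iter i h x = iter j h x.
  pose F (i : 'I_(#|{ffun T -> T}|).+1) := [ffun x => iter i h x].
  have /injectivePn [i [j ij E]] : ~~ injectiveb F.
    apply/negP => /injectiveP /leq_card; by rewrite card_ord ltnn.
  have {}E x : iter i h x = iter j h x.
    by have := congr1 (fun f : {ffun _} => f x) E; rewrite !ffunE.
  case: (ltngtP i j) => [lt|lt|/val_inj eq]; last by rewrite eq eqxx in ij.
    by exists i, j.
  by exists j, i; split=> // x; rewrite E.
have per k m x : i <= k -> iter (k + m * (j - i)) h x = iter k h x.
  move=> ik; elim: m => [|m IH]; first by rewrite addn0.
  have -> : k + m.+1 * (j - i) = (k + m * (j - i) - i) + j.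
    by rewrite mulSn; move: (m * _) => t; lia.
  by rewrite iterD -E -iterD -{}IH; congr (iter _ h x); move: (m * _) => t; lia.
(* A multiple of the period that is at least [i]; the factor [i.+1] keeps it positive when
   [i = 0]. *)
exists (i.+1 * (j - i)); first by rewrite muln_gt0 subn_gt0.
by move=> x; rewrite -iterD per //; nia.
Qed.

Section Retracts.
Variable Sigma : Type.
Implicit Types (X Y Z W : tree Sigma) (a : Sigma).

Lemma morph_comp X Y Z (f : tV X -> tV Y) fe (g : tV Y -> tV Z) ge :
  is_morph f fe -> is_morph g ge -> is_morph (g \o f) (ge \o fe).
Proof.
move=> [a1 [a2 [a3 [a4 a5]]]] [b1 [b2 [b3 [b4 b5]]]].
by do 4?[split]; move=> *; rewrite /= ?b1 ?a1 ?b2 ?a2 ?b3 ?a3 ?a4 ?a5.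
Qed.

Lemma morph_id X : @is_morph _ X X id id.
Proof. by do 4?[split]. Qed.

Lemma morph_iter X (h : tV X -> tV X) he n :
  is_morph h he -> is_morph (iter n h) (iter n he).
Proof.
by move=> m; elim: n => [|n IH]; [exact: morph_id | exact: morph_comp IH m].
Qed.

(** Some positive power of the endomorphism is idempotent, hence a retraction, hence the
    identity. *)
Lemma pruned_endo_injective X (h : tV X -> tV X) he :
  pruned X -> is_morph h he -> injective h /\ injective he.
Proof.
move=> pX m.
(* Vertices and edges are combined so that one exponent serves both. *)
pose H (z : tV X + tE X) : tV X + tE X :=
  match z with inl v => inl (h v) | inr e => inr (he e) end.
have [n n0 idm] := iter_idempotent H.
have Hl v : iter n H (inl v) = inl (iter n h v).
  by elim: (n) => //= k ->.
have Hr e : iter n H (inr e) = inr (iter n he e).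
  by elim: (n) => //= k ->.
have [hv hE] : (forall v, iter n h v = v) /\ (forall e, iter n he e = e).
  apply: pX; split; [exact: morph_iter | split=> [v|e]].
    by have := idm (inl v); rewrite !Hl => -[].
  by have := idm (inr e); rewrite !Hr => -[].
case: n n0 hv hE {idm Hl Hr} => // n _ hv hE.
by split=> x y xy; [rewrite -(hv x) -(hv y) | rewrite -(hE x) -(hE y)];
  rewrite !iterSr xy.
Qed.

Lemma bij_of_inj2 (S T : finType) (f : S -> T) (g : T -> S) :
  injective (g \o f) -> injective (f \o g) -> bijective f.
Proof.
move=> gf fg.
have fi : injective f by move=> x y xy; apply: gf; rewrite /= xy.
have gi : injective g by move=> x y xy; apply: fg; rewrite /= xy.
exact: inj_card_bij fi (leq_card _ gi).
Qed.

(** Both composites of the two morphisms are injective, and finiteness then makes each morphism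
    bijective. *)
Lemma pruned_eqv_iso X Y : pruned X -> pruned Y -> eqv X Y -> iso X Y.
Proof.
move=> pX pY [/hom_morph [f [fe mf]] /hom_morph [g [ge mg]]].
have [i1 i2] := pruned_endo_injective pX (morph_comp mf mg).
have [i3 i4] := pruned_endo_injective pY (morph_comp mg mf).
exists f, fe; split=> //; split; first exact: bij_of_inj2 i1 i3.
exact: bij_of_inj2 i2 i4.
Qed.

Lemma iso_refl X : iso X X.
Proof. by exists id, id; split; [exact: morph_id | split; exists id]. Qed.

Lemma iso_sym X Y : iso X Y -> iso Y X.
Proof.
move=> [f [fe [[m1 [m2 [m3 [m4 m5]]]] [[g fK gK] [ge feK geK]]]]].
exists g, ge; split; last by split; [exists f | exists fe].
split; [|split; [|split; [|split]]].
- by move=> e; rewrite -{2}(geK e) m1 fK.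
- by move=> e; rewrite -{2}(geK e) m2 fK.
- by move=> e; rewrite -{2}(geK e) m3.
- by rewrite -m4 fK.
- by rewrite -m5 fK.
Qed.

Lemma iso_trans Y X Z : iso X Y -> iso Y Z -> iso X Z.
Proof.
move=> [f [fe [m [b1 b2]]]] [g [ge [m' [b3 b4]]]]; exists (g \o f), (ge \o fe).
by split; [exact: morph_comp m m' | split; exact: bij_comp].
Qed.

Lemma iso_hom X Y : iso X Y -> hom X Y.
Proof. by move=> [f [fe [m _]]]; exact: morph_hom m. Qed.

Lemma iso_eqv X Y : iso X Y -> eqv X Y.
Proof. by move=> i; split; apply: iso_hom => //; exact: iso_sym. Qed.

(* A retract presented by its projection [p] and inclusion [j]. *)
Definition split_retract X Y : Prop :=
  exists (p : tV X -> tV Y) (pe : tE X -> tE Y) (j : tV Y -> tV X) (je : tE Y -> tE X),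
    [/\ is_morph p pe, is_morph j je, cancel j p & cancel je pe].

Lemma split_retract_trans Y X Z :
  split_retract X Y -> split_retract Y Z -> split_retract X Z.
Proof.
move=> [p [pe [j [je [mp mj jK jeK]]]]] [q [qe [k [ke [mq mk kK keK]]]]].
exists (q \o p), (qe \o pe), (j \o k), (je \o ke); split.
- exact: morph_comp mp mq.
- exact: morph_comp mk mj.
- exact: can_comp.
- exact: can_comp.
Qed.

Lemma split_retract_of X Y : split_retract X Y -> retract_of X Y.
Proof.
move=> [p [pe [j [je [mp mj jK jeK]]]]].
exists (j \o p), (je \o pe); split.
  split; first exact: morph_comp mp mj.
  by split=> v /=; rewrite ?jK ?jeK.
exists j, je; split=> //; split; first exact: can_inj jK.
split; first exact: can_inj jeK.
by split=> v; split=> [[w <-]|[w <-]]; by [exists (j w); rewrite /= jK |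
  exists (je w); rewrite /= jeK | exists (p w) | exists (pe w)].
Qed.

Lemma retract_of_eqv X Y : retract_of X Y -> eqv X Y.
Proof.
move=> [r [re [[mr [rK reK]] [j [je [mj [ij [ije [jr jer]]]]]]]]].
split; last exact: morph_hom mj.
have ex v : exists w, j w = r v by apply/jr; exists v.
pose p v := proj1_sig (constructive_indefinite_description _ (ex v)).
have jp v : j (p v) = r v by rewrite /p; case: constructive_indefinite_description.
exists p; case: (mj) (mr) => [j1 [j2 [j3 [j4 j5]]]] [r1 [r2 [r3 [r4 r5]]]].
split; last 2 first.
- by apply: ij; rewrite jp r4 j4.
- by apply: ij; rewrite jp r5 j5.
move=> u a v [e [<- [<- <-]]].
have [d dE] : exists d, je d = re e by apply/jer; exists e.
exists d; split; first by apply: ij; rewrite jp -j1 dE r1.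
split; first by apply: ij; rewrite jp -j2 dE r2.
by rewrite -j3 dE r3.
Qed.

Lemma split_retract_tree X Y : split_retract X Y -> is_tree X -> is_tree Y.
Proof.
move=> [p [pe [j [je [mp mj jK jeK]]]]] /is_treeP [cX bX dX]; apply/is_treeP.
case: (mp) (mj) => [p1 [p2 [p3 [p4 p5]]]] [j1 [j2 [j3 [j4 j5]]]].
split.
- by move=> u v; rewrite -(jK u) -(jK v); apply: uadj_map (morph_vhom mp) _.
- move=> e; have [c [ce cd]] := bX (je e).
  exists (c \o j); split=> [|d de] /=; first by rewrite -j1 -j2.
  by rewrite -j1 -j2 cd // (inj_eq (can_inj jeK)).
- by rewrite -p4 -p5; apply: dadj_map (morph_vhom mp) _.
Qed.

Section Image.
Variables (X : tree Sigma) (r : tV X -> tV X) (re : tE X -> tE X).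
Hypothesis retr : is_retraction r re.

Lemma retr_src (e : {e | re e == e}) : r (src (val e)) == src (val e).
Proof. by case: retr => [[m _] _]; rewrite -m (eqP (valP e)). Qed.

Lemma retr_tgt (e : {e | re e == e}) : r (tgt (val e)) == tgt (val e).
Proof. by case: retr => [[_ [m _]] _]; rewrite -m (eqP (valP e)). Qed.

Lemma retr_st : r (st X) == st X.
Proof. by case: retr => [[_ [_ [_ [-> _]]]] _]. Qed.

Lemma retr_en : r (en X) == en X.
Proof. by case: retr => [[_ [_ [_ [_ ->]]]] _]. Qed.

Definition imageT : tree Sigma :=
  @Tree Sigma {v | r v == v} {e | re e == e}
    (fun e => exist (fun v => r v == v) _ (retr_src e))
    (fun e => exist (fun v => r v == v) _ (retr_tgt e))
    (fun e => lbl (val e))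
    (exist (fun v => r v == v) _ retr_st) (exist (fun v => r v == v) _ retr_en).

Lemma image_split_retract : split_retract X imageT.
Proof.
case: (retr) => [[r1 [r2 [r3 [r4 r5]]]] [rK reK]].
have rv v : r (r v) == r v by rewrite rK.
have rev e : re (re e) == re e by rewrite reK.
exists (fun v => exist (fun v => r v == v) _ (rv v)),
  (fun e => exist (fun e => re e == e) _ (rev e)), val, val.
split.
- by do 4?[split]; move=> *; rewrite /=; do ?[apply: val_inj => /=].
- by do 4?[split].
- by move=> [v vP]; apply: val_inj => /=; apply/eqP.
- by move=> [v vP]; apply: val_inj => /=; apply/eqP.
Qed.

Lemma card_image :
  ~ ((forall v, r v = v) /\ (forall e, re e = e)) ->
  #|tV imageT| + #|tE imageT| < #|tV X| + #|tE X|.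
Proof.
move=> nid; rewrite ltn_neqAle !card_sig leq_add ?max_card // andbT.
apply/eqP => E; apply: nid.
have sum_max (a b c d : nat) : a <= c -> b <= d -> a + b = c + d -> a = c /\ b = d by lia.
have [hv he] := sum_max _ _ _ _ (max_card _) (max_card _) E.
have full (T : finType) (P : pred T) : #|[pred x | P x]| = #|T| -> forall x, P x.
  move=> EP x; have := cardC [pred x | P x]; rewrite EP => h.
  move/eqP: h; rewrite -[X in _ == X]addn0 eqn_add2l => /eqP /card0_eq /(_ x).
  by rewrite !inE => /negbFE.
by split=> v; apply/eqP; [exact: (full _ (fun v => r v == v)) |
  exact: (full _ (fun e => re e == e))].
Qed.
End Image.

(** Strong induction on the number of vertices and edges: a non-identity retraction has a strictly
    smaller image, and split retracts compose. *)
Lemma pruned_retract_exists X : exists2 Y, split_retract X Y & pruned Y.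
Proof.
have [n] := ubnP (#|tV X| + #|tE X|); elim: n X => // n IH X le.
have [pX|npX] := classic (pruned X).
  by exists X => //; exists id, id, id, id; split=> //; exact: morph_id.
have [r [re [rr nid]]] : exists r re, @is_retraction _ X r re /\
    ~ ((forall v, r v = v) /\ (forall e, re e = e)).
  apply: NNPP => h; apply: npX => r re rr; apply: NNPP => nid.
  by apply: h; exists r, re.
have [|Y XY pY] := IH (imageT rr).
  by apply: leq_trans (card_image rr nid) _.
by exists Y => //; apply: split_retract_trans XY; exact: image_split_retract.
Qed.

(** [overline] is an arbitrary choice unless some class qualifies. The pruned retract supplies one,
    being a tree as a split retract of a tree. *)
Lemma overline_spec X : is_tree X ->
  exists Y, retract_of X Y /\ pruned Y /\ proj1_sig (overline X) = iso Y.
Proof.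
move=> tX; apply: (epsilon_spec (T1_inhabited Sigma)
  (fun C => exists Y, retract_of X Y /\ pruned Y /\ proj1_sig C = iso Y)).
have [Y XY pY] := pruned_retract_exists X.
have h : is_T1class (iso Y) by exists Y; split=> //; exact: split_retract_tree XY tX.
by exists (exist _ _ h), Y; split=> //; exact: split_retract_of.
Qed.

Lemma rep_spec (C : T1 Sigma) :
  [/\ is_tree (rep C), pruned (rep C) & proj1_sig C = iso (rep C)].
Proof. by rewrite /rep; case: constructive_indefinite_description => X [? []]. Qed.

Lemma rep_tree (C : T1 Sigma) : is_tree (rep C).
Proof. by case: (rep_spec C). Qed.

Lemma rep_overline X : is_tree X -> eqv (rep (overline X)) X.
Proof.
move=> /overline_spec [Y [/retract_of_eqv XY [_ E]]].
apply: eqv_trans (eqv_sym XY); apply: iso_eqv; apply: iso_sym.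
have [_ _ E'] := rep_spec (overline X).
by rewrite -E E'; exact: iso_refl.
Qed.

Lemma rep_inj (C D : T1 Sigma) : eqv (rep C) (rep D) -> C = D.
Proof.
have [_ pC EC] := rep_spec C; have [_ pD ED] := rep_spec D.
move=> /(pruned_eqv_iso pC pD) i; apply: eq_sig_hprop.
  by move=> *; exact: proof_irrelevance.
rewrite EC ED; apply: functional_extensionality => Z.
apply: propositional_extensionality; split; first exact/iso_trans/iso_sym.
exact: iso_trans.
Qed.

End Retracts.

(** * Adequacy of the monoid of pruned trees *)

Section T1Adequate.
Variable Sigma : Type.
Implicit Types (X Y Z W : tree Sigma) (a : Sigma) (C D : T1 Sigma).

Lemma rep_mul C D : eqv (rep (mulT1 C D)) (prodT (rep C) (rep D)).
Proof. by apply/rep_overline/is_tree_prod; exact: rep_tree. Qed.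

Lemma rep_plus C : eqv (rep (plusT1 C)) (plusT (rep C)).
Proof. by apply/rep_overline/is_tree_plus; exact: rep_tree. Qed.

Lemma rep_star C : eqv (rep (starT1 C)) (starT (rep C)).
Proof. by apply/rep_overline/is_tree_star; exact: rep_tree. Qed.

Lemma rep_one : eqv (rep (oneT1 Sigma)) (trivialT Sigma).
Proof. exact/rep_overline/trivialT_is_tree. Qed.

Lemma mulT1_eqv C D X Y :
  eqv (rep C) X -> eqv (rep D) Y -> eqv (rep (mulT1 C D)) (prodT X Y).
Proof. by move=> hC hD; apply: eqv_trans (rep_mul C D) _; exact: eqv_prod. Qed.

(** Equations between classes become homomorphic equivalences of any convenient representatives, so
    the operations can be computed without pruning. *)
Lemma T1_eqP C D X Y :
  eqv (rep C) X -> eqv (rep D) Y -> (C = D <-> eqv X Y).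
Proof.
move=> hC hD; split=> [E|E].
  by apply: eqv_trans (eqv_sym hC) _; rewrite E.
by apply: rep_inj; apply: eqv_trans hC (eqv_trans E (eqv_sym hD)).
Qed.

Lemma T1_monoid : is_monoid (@mulT1 Sigma) (oneT1 Sigma).
Proof.
split=> [C D E|]; [|split=> C].
- apply/(T1_eqP (mulT1_eqv (eqv_refl _) (rep_mul D E))
                (mulT1_eqv (rep_mul C D) (eqv_refl _))).
  exact: prod_assoc.
- apply/(T1_eqP (mulT1_eqv rep_one (eqv_refl _)) (eqv_refl _)).
  exact: prod_trivial_l.
- apply/(T1_eqP (mulT1_eqv (eqv_refl _) rep_one) (eqv_refl _)).
  exact: prod_trivial_r.
Qed.

(* Comparing trunk lengths: an idempotent tree has an empty trunk. *)
Lemma idem_loop C : idem (@mulT1 Sigma) C -> st (rep C) = en (rep C).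
Proof.
move=> /(T1_eqP (rep_mul C C) (eqv_refl _)) [_ [f [hf fs fe]]].
have tC := rep_tree C; have [s w] := tree_walk tC.
have w2 : walk (st (prodT (rep C) (rep C))) (wmap injl s ++ wmap injr s)
    (en (prodT (rep C) (rep C))).
  apply: (walk_cat (v := injl (en (rep C)))).
    exact: walk_map (@vhom_injl _ (rep C) (rep C)) w.
  by rewrite -injr_st; apply: walk_map (@vhom_injr _ (rep C) (rep C)) w.
have := walk_map hf w; rewrite fs fe => w1.
have := congr1 size (tree_walk_unique (is_tree_prod tC tC) w1 w2).
rewrite size_cat !size_map; case: s w {w1 w2} => [//|x s] _ /=; lia.
Qed.

Lemma loop_idem C X : eqv (rep C) X -> st X = en X -> idem (@mulT1 Sigma) C.
Proof.
move=> E l; apply/(T1_eqP (mulT1_eqv E E) E); exact: prod_loop_idem.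
Qed.

Lemma idem_comm C D : idem (@mulT1 Sigma) C -> idem (@mulT1 Sigma) D ->
  mulT1 C D = mulT1 D C.
Proof.
move=> /idem_loop lC /idem_loop lD; apply/(T1_eqP (rep_mul C D) (rep_mul D C)).
by split; exact: hom_prod_loop_swap.
Qed.

(** The graphs agree on both sides and only the end vertices differ. Forwards, [hom_junction]
    controls the gluing vertex; backwards, [f] is kept on [X] and replaced by the inclusion on
    [A]. *)
Lemma hom_prod_plus X Y A : is_tree X -> is_tree Y -> is_tree A ->
  hom (prodT X A) (prodT Y A) <-> hom (prodT X (plusT A)) (prodT Y (plusT A)).
Proof.
move=> tX tY tA.
have [[[sX wX] [sY wY]] [sA wA]] := (tree_walk tX, tree_walk tY, tree_walk tA).
split=> [[f [hf fs fe]]|[f [hf fs fe]]].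
  exists f; split=> //.
  rewrite -[en (prodT X _)]/(@injr _ X A (st A)) injr_st.
  rewrite -[en (prodT Y _)]/(@injr _ Y A (st A)) injr_st.
  by apply: (hom_junction tY tA wX wY wA wA hf fs fe); right.
apply: (@hom_prod_glue _ X A (prodT Y A) (fun x => f (injl x)) injr) => //.
- exact: vhom_comp (@vhom_injl _ X A) hf.
- exact: vhom_injr.
- rewrite injr_st; move: fe.
  by rewrite -[en (prodT X _)]/(@injr _ X A (st A)) injr_st
    -[en (prodT Y _)]/(@injr _ Y A (st A)) injr_st.
Qed.

Lemma hom_star_prod X Y A : is_tree X -> is_tree Y -> is_tree A ->
  hom (prodT A X) (prodT A Y) <-> hom (prodT (starT A) X) (prodT (starT A) Y).
Proof.
move=> tX tY tA.
have [[[sX wX] [sY wY]] [sA wA]] := (tree_walk tX, tree_walk tY, tree_walk tA).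
split=> [[f [hf fs fe]]|[f [hf fs fe]]].
  exists f; split=> //.
  by apply: (hom_junction tA tY wA wA wX wY hf fs fe); left.
apply: (@hom_prod_glue _ A X (prodT A Y) injl (fun x => f (injr x))) => //.
- exact: vhom_injl.
- exact: vhom_comp (@vhom_injr _ A X) hf.
- by rewrite injr_st.
Qed.

Lemma T1_adequate :
  adequate_monoid (@mulT1 Sigma) (@plusT1 Sigma) (@starT1 Sigma) (oneT1 Sigma).
Proof.
split; first exact: T1_monoid.
split; first exact: idem_comm.
split=> C; split.
- exact: loop_idem (rep_plus C) erefl.
- move=> D E; have hp := hom_prod_plus (rep_tree _) (rep_tree _) (rep_tree C).
  apply: iff_trans (T1_eqP (rep_mul D C) (rep_mul E C)) _.
  apply: iff_trans _ (iff_sym (T1_eqP (mulT1_eqv (eqv_refl (rep D)) (rep_plus C))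
    (mulT1_eqv (eqv_refl (rep E)) (rep_plus C)))).
  by split=> -[h1 h2]; split; apply/hp.
- exact: loop_idem (rep_star C) erefl.
- move=> D E; have hp := hom_star_prod (rep_tree _) (rep_tree _) (rep_tree C).
  apply: iff_trans (T1_eqP (rep_mul C D) (rep_mul C E)) _.
  apply: iff_trans _ (iff_sym (T1_eqP (mulT1_eqv (rep_star C) (eqv_refl (rep D)))
    (mulT1_eqv (rep_star C) (eqv_refl (rep E))))).
  by split=> -[h1 h2]; split; apply/hp.
Qed.

End T1Adequate.

(** * Trees as terms *)

Section Terms.
Variable Sigma : Type.
Implicit Types (X Y Z W : tree Sigma) (a : Sigma).

Inductive term : Type :=
  | One | Gen of Sigma | Mul of term & term | Plus of term | Star of term.

Fixpoint realize (t : term) : tree Sigma :=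
  match t with
  | One => trivialT Sigma
  | Gen a => baseT a
  | Mul t1 t2 => prodT (realize t1) (realize t2)
  | Plus t => plusT (realize t)
  | Star t => starT (realize t)
  end.

Lemma realize_tree t : is_tree (realize t).
Proof.
elim: t => [|a|t1 h1 t2 h2|t h|t h] /=.
- exact: trivialT_is_tree.
- exact: is_tree_base.
- exact: is_tree_prod.
- exact: is_tree_plus.
- exact: is_tree_star.
Qed.

Section Models.
Variable X : tree Sigma.
Hypothesis brX : bridged X.

Definition adj_in (D : {set tE X}) : rel (tV X) := fun u v =>
  [exists e in D, ((src e == u) && (tgt e == v)) || ((src e == v) && (tgt e == u))].

Lemma adj_in_edge (D : {set tE X}) d : d \in D -> adj_in D (src d) (tgt d).
Proof. by move=> dD; apply/existsP; exists d; rewrite dD !eqxx. Qed.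

(* [t] represents the connected component of [u] in the subgraph of [X] with
   edge set [D], with start vertex [u] and end vertex [v]. *)
Definition models (D : {set tE X}) (u v : tV X) (t : term) : Prop :=
  exists (g : tV (realize t) -> tV X) (f : tV X -> tV (realize t)),
    [/\ vhom g, g (st (realize t)) = u, g (en (realize t)) = v,
        f u = st (realize t) /\ f v = en (realize t) &
        forall d, d \in D -> connect (adj_in D) u (src d) ->
          step (f (src d)) (lbl d) (f (tgt d))].

Lemma models_plus D u v t : models D u v t -> models D u u (Plus t).
Proof. by move=> [g [f [hg gs ge [fs fe] hf]]]; exists g, f; split. Qed.

Lemma models_star D u v t :
  connect (adj_in D) u v -> models D u v t -> models D v v (Star t).
Proof.
move=> c [g [f [hg gs ge [fs fe] hf]]]; exists g, f; split=> // d dD cd.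
exact: hf dD (connect_trans c cd).
Qed.

Lemma connect_split (D : {set tE X}) e x : connect (adj_in D) (src e) x ->
  connect (adj_in (D :\ e)) (src e) x \/ connect (adj_in (D :\ e)) (tgt e) x.
Proof.
apply: (connect_ind (P := fun x => connect (adj_in (D :\ e)) (src e) x \/
  connect (adj_in (D :\ e)) (tgt e) x)); first by left; exact: connect0.
move=> y z h /existsP [d /andP [dD yz]].
have [de|de] := eqVneq d e.
  by move: yz; rewrite de => /orP [/andP [_ /eqP <-]|/andP [/eqP <- _]];
    [right | left]; exact: connect0.
have c1 : connect (adj_in (D :\ e)) y z.
  by apply: connect1; apply/existsP; exists d; rewrite !inE de dD.
by case: h => h; [left | right]; exact: connect_trans h c1.
Qed.

Lemma bridge_disconnects (D : {set tE X}) e x :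
  connect (adj_in (D :\ e)) (src e) x -> connect (adj_in (D :\ e)) (tgt e) x -> False.
Proof.
have [c [ce cd]] := brX e.
have inv u v : connect (adj_in (D :\ e)) u v -> c u = c v.
  apply: (connect_ind (P := fun v => c u = c v)) => // y z -> /existsP [d].
  rewrite !inE => /andP [/andP [de _]].
  by case/orP => /andP [/eqP <- /eqP <-]; rewrite cd.
by move=> /inv h1 /inv h2; rewrite h1 h2 eqxx in ce.
Qed.

(** Removing the bridge [e] leaves two sides: [t1] is a loop at its source, [t2] continues the trunk
    from its target, and [e] joins them. *)
Lemma models_glue (D : {set tE X}) e v t1 t2 :
  e \in D -> models (D :\ e) (src e) (src e) t1 -> models (D :\ e) (tgt e) v t2 ->
  connect (adj_in (D :\ e)) (tgt e) v ->
  models D (src e) v (Mul t1 (Mul (Gen (lbl e)) t2)).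
Proof.
move=> eD [g1 [f1 [hg1 gs1 ge1 [fs1 fe1] hf1]]] [g2 [f2 [hg2 gs2 ge2 [fs2 fe2] hf2]]] cv.
pose B : tree Sigma := baseT (lbl e).
pose P2 := prodT B (realize t2).
pose gB (b : tV B) : tV X := if b then tgt e else src e.
have hgB : vhom gB by move=> u a w [[] [<- [<- <-]]]; exact: step_edge.
pose c1 := connect (adj_in (D :\ e)) (src e).
(* Reachability from [src e] decides the side. Vertices outside the component fall in the second
   case as a default; [models] constrains only edges of the component. *)
pose f x : tV (prodT (realize t1) P2) :=
  if c1 x then injl (f1 x) else injr (injr (f2 x) : tV P2).
have hB : gB (en B) = g2 (st (realize t2)) by rewrite gs2.
have h1B : g1 (en (realize t1)) = (copair gB g2 : tV P2 -> _) (st P2) by rewrite ge1.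
have nc1 x : connect (adj_in (D :\ e)) (tgt e) x -> c1 x = false.
  by move=> h; apply/negP => h'; exact: bridge_disconnects h' h.
exists (copair g1 (copair gB g2)), f; split.
- by apply: vhom_copair => //; exact: vhom_copair.
- by [].
- rewrite -[en _]/(injr (injr (en (realize t2)) : tV P2)) copair_injr //.
  by rewrite copair_injr.
- by rewrite /f (nc1 v) // fe2 /c1 connect0 fs1.
move=> d dD cd; have [->|de] := eqVneq d e.
  rewrite /f /c1 connect0 -/c1 (nc1 (tgt e)) ?connect0 // fe1 fs2.
  rewrite (injr_st B (realize t2)) -(injr_st (realize t1) P2).
  apply: (@vhom_injr _ (realize t1) P2).
  exact: (@vhom_injl _ B (realize t2)) (@step_edge _ B tt).
have dD' : d \in D :\ e by rewrite !inE de.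
have c' := connect1 (adj_in_edge dD').
case: (connect_split cd) => h; have h' := connect_trans h c'.
  by rewrite /f /c1 h h'; apply: vhom_injl; exact: hf1.
rewrite /f !nc1 //; apply: (@vhom_injr _ (realize t1) P2).
by apply: vhom_injr; exact: hf2.
Qed.

(** Induction on the number of edges: cut an edge at [u] and recurse on both sides. An outgoing edge
    puts [u] at the start, whence [Plus]; an incoming one puts it at the end, whence [Star]. *)
Lemma models_loop (D : {set tE X}) u : exists t, models D u u t.
Proof.
have [n] := ubnP #|D|; elim: n D u => // n IH D u le.
have lt e : e \in D -> #|D :\ e| < n by move=> eD; move: le; rewrite (cardsD1 e) eD.
have [/existsP [e /andP [eD /eqP eu]]|/existsPn nout] :=
  boolP [exists e, (e \in D) && (src e == u)].
  have [t1 m1] := IH _ (src e) (lt e eD).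
  have [t2 m2] := IH _ (tgt e) (lt e eD).
  rewrite -eu; exists (Plus (Mul t1 (Mul (Gen (lbl e)) t2))).
  exact: models_plus (models_glue eD m1 m2 (connect0 _ _)).
have [/existsP [e /andP [eD /eqP eu]]|/existsPn nin] :=
  boolP [exists e, (e \in D) && (tgt e == u)].
  have [t1 m1] := IH _ (src e) (lt e eD).
  have [t2 m2] := IH _ (tgt e) (lt e eD).
  rewrite -eu; exists (Star (Mul t1 (Mul (Gen (lbl e)) t2))).
  apply: models_star (models_glue eD m1 m2 (connect0 _ _)).
  exact/connect1/adj_in_edge.
exists One, (fun _ => u), (fun _ => tt); split=> //; first by move=> x a y [[]].
move=> d dD c; suff E : src d = u by have := nout d; rewrite dD E eqxx.
apply: (connect_ind (P := fun x => x = u)) c => // x y -> /existsP [d' /andP [d'D]].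
case/orP => /andP [/eqP h1 /eqP h2].
  by have := nout d'; rewrite d'D h1 eqxx.
by have := nin d'; rewrite d'D h2 eqxx.
Qed.

(** The part on the near side of the first edge becomes a loop, and the rest of the walk is treated
    without that edge. Connectivity is carried along because [models_glue] requires it. *)
Lemma models_ewalk (D : {set tE X}) s u v :
  ewalk u s v -> {subset s <= D} -> connect (adj_in D) u v /\ exists t, models D u v t.
Proof.
elim: s D u => [|e s IH] D u /=.
  by move=> -> _; split; [exact: connect0 | exact: models_loop].
move=> [<- w] sub.
have eD : e \in D by apply: sub; exact: mem_head.
have [x xs|c [t2 m2]] := IH (D :\ e) (tgt e) w.
  rewrite !inE sub ?inE ?xs ?orbT // andbT.
  by apply: contraNneq (bridged_notin brX w) => <-.
have [t1 m1] := models_loop (D :\ e) (src e).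
split; last by exists (Mul t1 (Mul (Gen (lbl e)) t2)); exact: models_glue.
apply: connect_trans (connect1 (adj_in_edge eD)) _.
apply: connect_sub c => x y /existsP [d /andP [dD h]]; apply: connect1.
by apply/existsP; exists d; rewrite h andbT; move: dD; rewrite !inE => /andP [].
Qed.

End Models.

(** With all edges in [D], the component of the start vertex is the whole tree, so both vertex maps
    given by [models] are homomorphisms. *)
Lemma tree_realize X : is_tree X -> exists t, eqv (realize t) X.
Proof.
move=> /is_treeP [cX bX /dconnect_ewalk [s w]].
have [|_ [t [g [f [hg gs ge [fs fe] hf]]]]] := models_ewalk bX (D := setT) w.
  by move=> x; rewrite inE.
exists t; split; first by exists g.
exists f; split=> // u a v [e [<- [<- <-]]]; apply: hf; first by rewrite inE.
have := cX (st X) (src e); congr is_true; apply: eq_connect => x y.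
by apply: eq_existsb => d; rewrite inE.
Qed.

End Terms.

(** * Adequate monoids *)

(** Reversing the multiplication exchanges [plus] and [star]; the basic laws of [star] are read off
    from those of [plus] this way. *)
Lemma adequate_opp (M : Type) (mul : M -> M -> M) (plus star : M -> M) (one : M) :
  adequate_monoid mul plus star one ->
  adequate_monoid (fun x y => mul y x) star plus one.
Proof.
move=> [[mA [m1 m2]] [cm [hp hs]]]; split; first by split=> [x y z|]; rewrite ?mA.
by split; [move=> e f ie jf; exact: cm | split].
Qed.

Section LeftIdentities.
Variables (M : Type) (mul : M -> M -> M) (plus star : M -> M) (one : M).
Hypothesis adq : adequate_monoid mul plus star one.
Local Notation "x * y" := (mul x y).
Local Notation idem := (idem mul).

(** The natural order on the semilattice of idempotents. *)
Definition idem_le e f : Prop := e * f = e.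

Lemma mulA x y z : x * (y * z) = x * y * z.
Proof. by case: adq => [[]]. Qed.
Lemma mul1 x : one * x = x.
Proof. by case: adq => [[? []]]. Qed.
Lemma mulr1 x : x * one = x.
Proof. by case: adq => [[? []]]. Qed.
Lemma idemC e f : idem e -> idem f -> e * f = f * e.
Proof. by case: adq => [? [h _]]; exact: h. Qed.
Lemma plus_idem a : idem (plus a).
Proof. by case: adq => [? [_ [h _]]]; case: (h a). Qed.
Lemma plusP a x y : x * a = y * a <-> x * plus a = y * plus a.
Proof. by case: adq => [? [_ [h _]]]; case: (h a) => _; apply. Qed.
Lemma idem1 : idem one.
Proof. exact: mul1. Qed.

Lemma idemM e f : idem e -> idem f -> idem (e * f).
Proof.
by move=> ie jf; rewrite /Defs.idem -mulA (mulA f) (idemC jf ie) -mulA jf mulA ie.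
Qed.

Lemma idem_le_trans f e g : idem_le e f -> idem_le f g -> idem_le e g.
Proof. by rewrite /idem_le => ef fg; rewrite -ef -mulA fg. Qed.

Lemma idem_le_antisym e f : idem e -> idem f -> idem_le e f -> idem_le f e -> e = f.
Proof. by rewrite /idem_le => ie jf ef fe; rewrite -ef idemC. Qed.

Lemma idem_le_meet e f g : idem_le e f -> idem_le e g -> idem_le e (f * g).
Proof. by rewrite /idem_le => ef eg; rewrite mulA ef. Qed.

Lemma plus_mul a : plus a * a = a.
Proof. by rewrite -[RHS]mul1; apply: (proj2 (plusP _ _ _)); rewrite plus_idem mul1. Qed.

(** With [plus_mul], this makes [plus a] the least idempotent fixing [a] on the left: the equation
    [x * a = one * a] transfers to [plus a] along [Rstar]. *)
Lemma plus_le x a : idem x -> x * a = a -> idem_le (plus a) x.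
Proof.
move=> ix xa; rewrite /idem_le idemC //; last exact: plus_idem.
by rewrite -[RHS]mul1; apply: (proj1 (plusP _ _ _)); rewrite mul1.
Qed.

Lemma plus_eq a b : (forall x y, x * a = y * a <-> x * b = y * b) -> plus a = plus b.
Proof.
move=> ab; apply: idem_le_antisym; try exact: plus_idem.
  apply: plus_le; first exact: plus_idem.
  by rewrite -[RHS]mul1; apply: (proj2 (ab _ _)); rewrite plus_mul mul1.
apply: plus_le; first exact: plus_idem.
by rewrite -[RHS]mul1; apply: (proj1 (ab _ _)); rewrite plus_mul mul1.
Qed.

Lemma plus_id e : idem e -> plus e = e.
Proof.
move=> ie; apply: idem_le_antisym => //; first exact: plus_idem.
  exact: plus_le.
by rewrite /idem_le idemC ?plus_mul //; exact: plus_idem.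
Qed.

(** [Rstar] is a left congruence, so [b] may be replaced by [plus b] under a left factor. *)
Lemma plus_mul_plus a b : plus (a * plus b) = plus (a * b).
Proof. by apply: plus_eq => x y; rewrite !mulA; apply: iff_sym (plusP _ _ _). Qed.

Lemma plus_idem_mul e a : idem e -> plus (e * a) = e * plus a.
Proof.
move=> ie; rewrite -plus_mul_plus plus_id //; apply: idemM => //; exact: plus_idem.
Qed.

Lemma plus_mul_le a b : idem_le (plus (a * b)) (plus a).
Proof. by apply: plus_le; [exact: plus_idem | rewrite mulA plus_mul]. Qed.

Lemma plus_mono a e f : idem e -> idem f -> idem_le e f ->
  idem_le (plus (a * e)) (plus (a * f)).
Proof.
move=> ie jf ef; apply: plus_le; first exact: plus_idem.
have -> : a * e = a * f * e by rewrite -mulA (idemC jf ie) ef.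
by rewrite mulA plus_mul.
Qed.

(** Since [p * a] absorbs [s] on the right, [s] can be inserted after [a] once [p] stands in front.
    With [s = star (p * a)] this is an edge inequality for the labelling of a generator. *)
Lemma plus_le_insert p a s q : idem p -> p * a * s = p * a ->
  idem_le (p * plus (a * q)) (plus (a * (s * q))).
Proof.
move=> ip pas; rewrite -plus_idem_mul //; apply: plus_le; first exact: plus_idem.
have -> : p * (a * q) = p * (a * (s * q)) by rewrite !mulA pas.
by rewrite mulA (idemC (plus_idem _) ip) -mulA plus_mul.
Qed.

End LeftIdentities.

(** * Good labellings *)

Section Evaluation.
Variables (Sigma M : Type) (mul : M -> M -> M) (plus star : M -> M) (one : M).
Hypothesis adq : adequate_monoid mul plus star one.
Variable chi : Sigma -> M.
Local Notation "x * y" := (mul x y).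
Local Notation idem := (idem mul).
Local Notation le := (idem_le mul).
Let opp := adequate_opp adq.
Let pI := plus_idem adq.
Let sI : forall a, idem (star a) := plus_idem opp.
Let iC := idemC adq.

Lemma mul_star a : a * star a = a.
Proof. exact: (plus_mul opp). Qed.

Lemma star_id e : idem e -> star e = e.
Proof. exact: (plus_id opp). Qed.

Lemma star_star_mul a b : star (star a * b) = star (a * b).
Proof. exact: (plus_mul_plus opp). Qed.

Lemma star_mul_le a b : le (star (b * a)) (star a).
Proof. by rewrite /idem_le iC; [exact: (plus_mul_le opp) | |]; exact: sI. Qed.

Lemma star_mono a e f : idem e -> idem f -> le e f -> le (star (e * a)) (star (f * a)).
Proof.
move=> ie jf; rewrite /idem_le iC // => ef; rewrite iC; [|exact: sI|exact: sI].
exact: (plus_mono opp).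
Qed.

Lemma star_le_insert p a s q : idem q -> idem p -> idem s -> s * (a * q) = a * q ->
  le (star (p * a) * q) (star (p * s * a)).
Proof.
move=> iq ip is_ saq; rewrite /idem_le iC; [|by apply: (idemM adq)|exact: sI].
exact: (plus_le_insert opp).
Qed.

Fixpoint eval (t : term Sigma) : M :=
  match t with
  | One => one
  | Gen a => chi a
  | Mul t1 t2 => eval t1 * eval t2
  | Plus t => plus (eval t)
  | Star t => star (eval t)
  end.

(* Motivating example: the label of [v] is the value in [M] of the tree rerooted
   with both start and end at [v]. *)
Definition good (X : tree Sigma) (lam : tV X -> M) : Prop :=
  (forall v, idem (lam v)) /\
  forall u a v, step u a v ->
    le (lam u) (plus (chi a * lam v)) /\ le (lam v) (star (lam u * chi a)).

Lemma good_vhom X Y (f : tV X -> tV Y) lam : vhom f -> good lam -> good (lam \o f).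
Proof. by move=> hf [i h]; split=> [v|u a v s]; [exact: i | exact: h (hf _ _ _ s)]. Qed.

Lemma good_copair X Y (lam : tV X -> M) (mu : tV Y -> M) :
  lam (en X) = mu (st Y) -> good lam -> good mu -> good (copair lam mu).
Proof.
move=> e [li lg] [mi mg]; split.
  by apply: prodT_ind => [x|y]; [exact: li | rewrite copair_injr].
move=> u a v h; case: (prod_step h) => -[x [x' [ux vx s]]]; rewrite ux vx /=.
  exact: lg s.
by rewrite !copair_injr //; exact: mg s.
Qed.

(** The edge inequalities chain along a whole realization, [eval t] replacing the edge label. This
    bounds the label of a gluing vertex from each factor. *)
Lemma good_bounds t (lam : tV (realize t) -> M) : good lam ->
  le (lam (st (realize t))) (plus (eval t * lam (en (realize t)))) /\
  le (lam (en (realize t))) (star (lam (st (realize t)) * eval t)).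
Proof.
elim: t lam => [|a|t1 IH1 t2 IH2|t IH|t IH] lam gl; have [li lg] := gl.
- by rewrite /= (mul1 adq) (mulr1 adq) (plus_id adq) // star_id //; split; exact: li.
- exact: (lg _ _ _ (@step_edge _ (baseT a) tt)).
- have [a1 b1] := IH1 _ (good_vhom (@vhom_injl _ (realize t1) (realize t2)) gl).
  have [a2 b2] := IH2 _ (good_vhom (@vhom_injr _ (realize t1) (realize t2)) gl).
  rewrite /= !injr_st in a1 b1 a2 b2 *; split.
  + apply: (idem_le_trans adq) a1 _; rewrite -(mulA adq) -(plus_mul_plus adq _ (_ * _)).
    exact: (plus_mono adq).
  + apply: (idem_le_trans adq) b2 _; rewrite (mulA adq) -(star_star_mul (_ * _)).
    exact: star_mono.
- have [a1 _] := IH lam gl; rewrite /=.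
  have {}a1 := idem_le_trans adq a1 (plus_mul_le adq _ _).
  rewrite (plus_id adq (idemM adq (pI _) (li _))).
  rewrite (star_id (idemM adq (li _) (pI _))).
  by split; apply: (idem_le_meet adq) => //; exact: li.
- have [_ b1] := IH lam gl; rewrite /=.
  have {}b1 := idem_le_trans adq b1 (star_mul_le _ _).
  rewrite (plus_id adq (idemM adq (sI _) (li _))).
  rewrite (star_id (idemM adq (li _) (sI _))).
  by split; apply: (idem_le_meet adq) => //; exact: li.
Qed.

Fixpoint wval (X : tree Sigma) (lam : tV X -> M) (u : tV X) s : M :=
  if s is x :: s' then lam u * chi x.1 * wval lam x.2 s' else lam u.

Lemma wval_idem_l X (lam : tV X -> M) u s : good lam ->
  lam u * wval lam u s = wval lam u s.
Proof. by move=> [i _]; case: s => [|x s] /=; rewrite ?(mulA adq) i. Qed.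

Lemma wval_cat X (lam : tV X -> M) u s1 v s2 : good lam -> walk u s1 v ->
  wval lam u (s1 ++ s2) = wval lam u s1 * wval lam v s2.
Proof.
move=> g; elim: s1 u => [|x s1 IH] u /=; first by move=> ->; rewrite wval_idem_l.
by move=> [_ /IH ->]; rewrite !(mulA adq).
Qed.

Lemma wval_map X Y (f : tV X -> tV Y) (lam : tV Y -> M) u s :
  wval lam (f u) (wmap f s) = wval (lam \o f) u s.
Proof. by elim: s u => [|x s IH] u //=; rewrite IH. Qed.

(* [p] and [q] stand for the values of what precedes and follows [X] in a larger
   product; carrying them along makes the labellings of two factors agree at
   the vertex where they are glued. *)
Definition canonical (X : tree Sigma) (m p q : M) (lam : tV X -> M) : Prop :=
  [/\ good lam, lam (st X) = p * plus (m * q), lam (en X) = star (p * m) * q,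
      forall mu, good mu -> le (mu (st X)) p -> le (mu (en X)) q ->
        forall v, le (mu v) (lam v) &
      exists2 s, walk (st X) s (en X) & wval lam (st X) s = p * m * q].

Lemma canonical_exists t p q : idem p -> idem q ->
  exists lam, @canonical (realize t) (eval t) p q lam.
Proof.
elim: t p q => [|a|t1 IH1 t2 IH2|t IH|t IH] p q ip iq.
- exists (fun _ => p * q); split.
  + by split=> [_|u a v [[]]]; exact: (idemM adq).
  + by rewrite /= (mul1 adq) (plus_id adq).
  + by rewrite /= (mulr1 adq) star_id.
  + by move=> mu _ h1 h2 []; apply: (idem_le_meet adq); [exact: h1 | exact: h2].
  + by exists [::] => //=; rewrite (mulr1 adq).
- have iL : idem (p * plus (chi a * q)) by apply: (idemM adq).
  have iR : idem (star (p * chi a) * q) by apply: (idemM adq).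
  exists (fun b : bool => if b then star (p * chi a) * q else p * plus (chi a * q)).
  split=> //.
  + split=> [[]|u b v [[] [<- [<- <-]]]] //=; split.
      by apply: (plus_le_insert adq) => //; rewrite mul_star.
    by apply: star_le_insert => //; rewrite (plus_mul adq).
  + move=> mu [mi mg] h1 h2 [].
      apply: (idem_le_meet adq) => //.
      apply: (idem_le_trans adq) (proj2 (mg _ _ _ (@step_edge _ (baseT a) tt))) _.
      exact: star_mono.
    apply: (idem_le_meet adq) => //.
    apply: (idem_le_trans adq) (proj1 (mg _ _ _ (@step_edge _ (baseT a) tt))) _.
    exact: (plus_mono adq).
  + exists [:: (a, true)]; first by split=> //; exact: (@step_edge _ (baseT a) tt).
    (* In [p * plus (chi a * q) * chi a * (star (p * chi a) * q)] the [star] is absorbed by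
       [p * chi a] and the [plus] by [chi a * q]. *)
    rewrite /= (iC ip (pI _)) !(mulA adq) -!(mulA adq _ p) -(mulA adq _ (p * chi a)).
    rewrite mul_star !(mulA adq) -(iC ip (pI _)) -!(mulA adq).
    by rewrite (plus_mul adq).
(* Each factor sees the other through its context. With these contexts both labellings put
   [star (p * eval t1) * plus (eval t2 * q)] on the gluing vertex. *)
- have [l1 [g1 s1 e1 m1 [w1 W1 V1]]] := IH1 p (plus (eval t2 * q)) ip (pI _).
  have [l2 [g2 s2 e2 m2 [w2 W2 V2]]] := IH2 (star (p * eval t1)) q (sI _) iq.
  have E : l1 (en (realize t1)) = l2 (st (realize t2)) by rewrite e1 s2.
  have G : good (copair l1 l2) by apply: good_copair.
  have Cr y : copair l1 l2 (injr y) = l2 y by rewrite copair_injr.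
  exists (copair l1 l2); split=> //.
  + by rewrite -[st _]/(injl (st (realize t1))) /= s1 (plus_mul_plus adq) (mulA adq).
  + by rewrite -[en _]/(injr (en (realize t2))) Cr e2 star_star_mul /= (mulA adq).
  + move=> mu gmu h1 h2.
    have gl := good_vhom (@vhom_injl _ (realize t1) (realize t2)) gmu.
    have gr := good_vhom (@vhom_injr _ (realize t1) (realize t2)) gmu.
    have mi : forall v, idem (mu v) by case: gmu.
    (* Maximality of [l1] and [l2] requires [mu] to lie below their contexts at the gluing vertex;
       crossing the other factor gives these bounds. *)
    have [_ b1] := good_bounds gl; have [a2 _] := good_bounds gr.
    apply: prodT_ind => [x|y].
      apply: (m1 _ gl) => //; rewrite /= -injr_st.
      by apply: (idem_le_trans adq) a2 _; apply: (plus_mono adq) => //=.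
    rewrite Cr; apply: (m2 _ gr) => //; rewrite /= injr_st.
    by apply: (idem_le_trans adq) b1 _; apply: star_mono => //=.
  + exists (wmap injl w1 ++ wmap injr w2).
      apply: (walk_cat (v := injl (en (realize t1)))).
        exact: walk_map (@vhom_injl _ (realize t1) (realize t2)) W1.
      rewrite -injr_st.
      exact: walk_map (@vhom_injr _ (realize t1) (realize t2)) W2.
    have W1' := walk_map (@vhom_injl _ (realize t1) (realize t2)) W1.
    rewrite -[st _]/(injl (st (realize t1))) (wval_cat _ G W1') -injr_st !wval_map.
    have -> : copair l1 l2 \o injr = l2 by apply: functional_extensionality.
    (* The idempotents [plus (eval t2 * q)] and [star (p * eval t1)] meet at the junction; once
       commuted, each is absorbed by its neighbour. *)
    rewrite -[copair l1 l2 \o injl]/l1 V1 V2 /= !(mulA adq).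
    rewrite -(mulA adq _ (plus _) (star _)) (iC (pI _) (sI _)) !(mulA adq) mul_star.
    by rewrite -!(mulA adq) (plus_mul adq).
(* Start and end coincide in [Plus t], so both contexts act at the start of [t] and its end is left
   unconstrained. [Star] is dual. *)
- have [lam [g s e m _]] := IH (p * q) one (idemM adq ip iq) (idem1 adq).
  rewrite (mulr1 adq) in s.
  have S : lam (st (realize t)) = p * plus (eval t) * q.
    by rewrite s -(mulA adq) (iC iq (pI _)) (mulA adq).
  exists lam; split=> //=.
  + by rewrite S -(mulA adq) (plus_id adq (idemM adq (pI _) iq)).
  + by rewrite S (star_id (idemM adq ip (pI _))).
  + move=> mu gmu h1 h2; apply: m => //; first exact: (idem_le_meet adq).
    by rewrite /idem_le (mulr1 adq).
  + by exists [::].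
- have [lam [g s e m _]] := IH one (p * q) (idem1 adq) (idemM adq ip iq).
  rewrite (mul1 adq) in e.
  have S : lam (en (realize t)) = p * star (eval t) * q.
    by rewrite e (mulA adq) (iC (sI _) ip).
  exists lam; split=> //=.
  + by rewrite S -(mulA adq) (plus_id adq (idemM adq (sI _) iq)).
  + by rewrite S (star_id (idemM adq ip (sI _))).
  + move=> mu gmu h1 h2; apply: m => //; last exact: (idem_le_meet adq).
    by rewrite /idem_le (mulr1 adq).
  + by exists [::].
Qed.

(** With both contexts [one], the canonical labellings are the greatest good ones. Pulling each back
    along the other homomorphism gives inequalities both ways, hence equality at vertices fixed by
    [g \o f], in particular on the trunk. *)
Lemma eval_eqv t t' : eqv (realize t) (realize t') -> eval t = eval t'.
Proof.
move=> [[f [hf fs fe]] [g [hg gs ge]]].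
have i1 := idem1 adq.
have [lam [gl _ _ ml [s ws vs]]] := canonical_exists t i1 i1.
have [mu [gm _ _ mm [s' ws' vs']]] := canonical_exists t' i1 i1.
have le1 x : le x one by rewrite /idem_le (mulr1 adq).
have L v : le (mu (f v)) (lam v).
  exact: (ml (mu \o f) (good_vhom hf gm) (le1 _) (le1 _)).
have L' v : le (lam (g v)) (mu v).
  exact: (mm (lam \o g) (good_vhom hg gl) (le1 _) (le1 _)).
have E v : g (f v) = v -> lam v = mu (f v).
  case: gl gm => [il _] [im _] gf; apply: (idem_le_antisym adq) => //.
  by rewrite -{1}gf.
(* Uniqueness of walks makes [f] and [g] mutually inverse on the trunks. *)
have fS : wmap f s = s'.
  have := walk_map hf ws; rewrite fs fe => w.
  exact: tree_walk_unique (realize_tree t') w ws'.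
have gS : wmap g (wmap f s) = s.
  rewrite fS; have := walk_map hg ws'; rewrite gs ge => w.
  exact: tree_walk_unique (realize_tree t) w ws.
rewrite !(mul1 adq) !(mulr1 adq) in vs vs'; rewrite -vs -vs' -fS -fs wval_map.
have : g (f (st (realize t))) = st (realize t) by rewrite fs gs.
elim: s (st (realize t)) gS {ws vs fS} => [|[a v] s IH] u /= gS gf; first exact: E.
by case: gS => gv gS; rewrite (E _ gf) (IH v gS gv).
Qed.

End Evaluation.

(** * The universal property *)

Theorem theorem5p15 (Sigma : Type) :
  adequate_monoid (@mulT1 Sigma) (@plusT1 Sigma) (@starT1 Sigma) (oneT1 Sigma) /\
  forall (M : Type) (mul : M -> M -> M) (plus star : M -> M) (one : M),
    adequate_monoid mul plus star one ->
    forall chi : Sigma -> M,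
      exists f : T1 Sigma -> M,
        (is_hom (@mulT1 Sigma) (@plusT1 Sigma) (@starT1 Sigma) (oneT1 Sigma)
                mul plus star one f /\ forall a, f (genT1 a) = chi a) /\
        forall g : T1 Sigma -> M,
          is_hom (@mulT1 Sigma) (@plusT1 Sigma) (@starT1 Sigma) (oneT1 Sigma)
                 mul plus star one g /\ (forall a, g (genT1 a) = chi a) ->
          forall x, g x = f x.
Proof.
split; first exact: T1_adequate.
move=> M mul plus star one adq chi.
(* A term is chosen for each class; by [eval_eqv] its value does not depend on the choice. *)
pose ex (C : T1 Sigma) :=
  constructive_indefinite_description _ (tree_realize (rep_tree C)).
pose tm C := proj1_sig (ex C).
have tmP C : eqv (realize (tm C)) (rep C) by rewrite /tm; case: (ex C).
pose ev := eval mul plus star one chi.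
have evE t C : eqv (rep C) (realize t) -> ev (tm C) = ev t.
  by move=> h; apply: (eval_eqv adq); apply: eqv_trans (tmP C) h.
have rt C := eqv_sym (tmP C).
exists (fun C => ev (tm C)); split; [split; [split; [|split; [|split]]|]|].
- move=> C D; rewrite (evE (Mul (tm C) (tm D))) //.
  exact: mulT1_eqv (rt C) (rt D).
- move=> C; rewrite (evE (Plus (tm C))) //.
  exact: eqv_trans (rep_plus C) (eqv_plus (rt C)).
- move=> C; rewrite (evE (Star (tm C))) //.
  exact: eqv_trans (rep_star C) (eqv_star (rt C)).
- by rewrite (evE (One Sigma)) //; exact: rep_one.
- by move=> a; rewrite (evE (Gen a)) //; exact/rep_overline/is_tree_base.
move=> g [[gM [gP [gS g1]]] gG] C.
(* Induction on terms forces the values of any morphism extending [chi], and every class is that of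
   a realized term. *)
have rec t : g (overline (realize t)) = ev t.
  have ro (t' : term Sigma) : eqv (rep (overline (realize t'))) (realize t').
    exact/rep_overline/realize_tree.
  elim: t => [|a|t1 h1 t2 h2|t h|t h]; [exact: g1 | exact: gG | | |].
  + rewrite -[ev _]/(mul (ev t1) (ev t2)) -h1 -h2 -gM; apply: (congr1 g).
    apply: rep_inj; apply: eqv_trans (ro (Mul t1 t2)) _.
    exact/eqv_sym/mulT1_eqv.
  + rewrite -[ev _]/(plus (ev t)) -h -gP; apply: (congr1 g).
    apply: rep_inj; apply: eqv_trans (ro (Plus t)) _.
    exact: eqv_sym (eqv_trans (rep_plus _) (eqv_plus (ro t))).
  + rewrite -[ev _]/(star (ev t)) -h -gS; apply: (congr1 g).
    apply: rep_inj; apply: eqv_trans (ro (Star t)) _.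
    exact: eqv_sym (eqv_trans (rep_star _) (eqv_star (ro t))).
rewrite -rec; congr g; apply: rep_inj.
exact: eqv_trans (rt C) (eqv_sym (rep_overline (realize_tree _))).
Qed.
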